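(* Let $c>0$, $k>0$ and $\varepsilon\in(-1,1)$. Let $Z$ be a continuous random variable having the Burr III distribution with parameters $c$ and $k$, and let $U$ be a discrete random variable, independent of $Z$, with $$P(U=1+\varepsilon)=\frac{1+\varepsilon}{2},\qquad P(U=-(1-\varepsilon))=\frac{1-\varepsilon}{2}.$$ Then the random variable $X=ZU$ has the distribution function $$F(x)=\begin{cases}\dfrac{1-\varepsilon}{2}+\dfrac{1+\varepsilon}{2}\left(1+\left(\dfrac{x}{1+\varepsilon}\right)^{-c}\right)^{-k}, & x\ge 0,\\[2mm] \dfrac{1-\varepsilon}{2}\left(1-\left(1+\left(\dfrac{-x}{1-\varepsilon}\right)^{-c}\right)^{-k}\right), & x<0,\end{cases}$$ and the density function $$f(x)=\frac{ck}{2}\left(\frac{\operatorname{sign}(x)\,x}{1+\operatorname{sign}(x)\,\varepsilon}\right)^{-(c+1)}\left(1+\left(\frac{\operatorname{sign}(x)\,x}{1+\operatorname{sign}(x)\,\varepsilon}\right)^{-c}\right)^{-(k+1)},\qquad x\in\mathbb{R}\setminus\{0\}.$$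
   Context: The Burr III distribution with shape parameters $c>0$, $k>0$ is the distribution on $(0,\infty)$ with density $g(z)=ck\,z^{-(c+1)}(1+z^{-c})^{-(k+1)}$ and distribution function $G(z)=(1+z^{-c})^{-k}$ for $z>0$. At $x=0$ the expression $(1+(x/(1+\varepsilon))^{-c})^{-k}$ is understood as its limit as $x\to 0^+$, namely $0$. Here $\operatorname{sign}(x)=1$ for $x>0$ and $\operatorname{sign}(x)=-1$ for $x<0$. *)

(* Defs.v *)
From HB Require Import structures.
From mathcomp Require Import all_boot all_order all_algebra.
From mathcomp Require Import all_classical all_reals all_analysis.
From mathcomp Require Import measurable_realfun.

Set Implicit Arguments.
Unset Strict Implicit.
Unset Printing Implicit Defensive.

Import Order.TTheory GRing.Theory Num.Theory.
Import numFieldNormedType.Exports.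

Local Open Scope classical_set_scope.
Local Open Scope ring_scope.

Definition has_density (R : realType) (d : measure_display)
    (T : measurableType d) (P : probability T R) (X : {RV P >-> R})
    (f : R -> R) : Prop :=
  [/\ measurable_fun setT f,
      (forall x, 0 <= f x) &
      forall A : set R, measurable A ->
        distribution P X A = (\int[@lebesgue_measure R]_(x in A) (f x)%:E)%E].

Definition independent_RV (R : realType) (d : measure_display)
    (T : measurableType d) (P : probability T R) (X Y : {RV P >-> R}) : Prop :=
  forall A B : set R, measurable A -> measurable B ->
    P (X @^-1` A `&` Y @^-1` B) = (P (X @^-1` A) * P (Y @^-1` B))%E.

(* The guards [0 < z] are needed because [powR] is total, with junk values
   (0 `^ a = 0 for a != 0, and z `^ a = 1 for z < 0). The value
   [burr3_cdf c k 0 = 0] is the limit at 0+ of the formula. *)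
Definition burr3_pdf (R : realType) (c k z : R) : R :=
  if 0 < z then
    c * k * z `^ (- (c + 1)) * (1 + z `^ (- c)) `^ (- (k + 1))
  else 0.

Definition burr3_cdf (R : realType) (c k z : R) : R :=
  if 0 < z then (1 + z `^ (- c)) `^ (- k) else 0.

Definition skew_burr3_cdf (R : realType) (c k e x : R) : R :=
  if 0 <= x then
    (1 - e) / 2 + (1 + e) / 2 * burr3_cdf c k (x / (1 + e))
  else
    (1 - e) / 2 * (1 - burr3_cdf c k (- x / (1 - e))).

(* Only meaningful for x != 0, where [Num.sg x] is 1 or -1 and the base of
   the powers is positive; the value at 0 is irrelevant for a density. *)
Definition skew_burr3_pdf (R : realType) (c k e x : R) : R :=
  let y := Num.sg x * x / (1 + Num.sg x * e) in
  c * k / 2 * y `^ (- (c + 1)) * (1 + y `^ (- c)) `^ (- (k + 1)).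

(* Main.v *)
Require Import Defs.
From HB Require Import structures.
From mathcomp Require Import all_boot all_order all_algebra.
From mathcomp Require Import all_classical all_reals all_analysis.
From mathcomp Require Import measurable_realfun.
From mathcomp Require Import ring lra.

Set Implicit Arguments.
Unset Strict Implicit.
Unset Printing Implicit Defensive.

Import Order.TTheory GRing.Theory Num.Theory.
Import numFieldNormedType.Exports.

Local Open Scope classical_set_scope.
Local Open Scope ring_scope.

(* Since U takes only the values u = 1 + e and v = - (1 - e), independence gives
   P(ZU \in A) = (1 + e)/2 P(uZ \in A) + (1 - e)/2 P(vZ \in A). The density of X
   follows by a linear change of variable in each term: the weights cancel
   against 1/|u| and 1/|v|. For the distribution function, antidifferentiating
   the density on [z, +oo[ with z > 0 yields P(Z >= z) = 1 - G(z); working with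
   tails avoids the singularity of the formulas at 0. *)

(** * Scaling of Lebesgue measure and of integrals *)

Section lebesgue_dilation.
Context {R : realType}.
Local Notation mu := (@lebesgue_measure R).

(** Half-open intervals are the sets on which uniqueness of Lebesgue measure is tested. A negative
    factor exchanges the end points, so the closed end moves to the left. *)
Lemma preimage_mul_ocitv (a x y : R) : a != 0 ->
  *%R a @^-1` `]x, y] =
  (if 0 < a then `](x / a), (y / a)] else `[(y / a), (x / a)[)%classic.
Proof.
move=> a0; case: ifPn => [a_gt0|].
  apply/seteqP; split=> z; rewrite /= !in_itv /= [a * z]mulrC.
    by rewrite ltr_pdivrMr// ler_pdivlMr.
  by rewrite ltr_pdivrMr// ler_pdivlMr.
rewrite -leNgt le_eqVlt (negbTE a0)/= => a_lt0.
by apply/seteqP; split=> z; rewrite /= !in_itv /= [a * z]mulrC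
  ler_ndivrMr// ltr_ndivlMr// andbC.
Qed.

(** The left side is a measure in [A] that gives each half-open interval its length, so uniqueness
    of Lebesgue measure applies. *)
Lemma lebesgue_measure_dilation (a : R) (A : set R) : a != 0 -> measurable A ->
  (`|a|%:E * pushforward mu ( *%R a : _ -> measurableTypeR R) A)%E = mu A.
Proof.
move=> a0 mA.
have ma : measurable_fun setT ( *%R a : measurableTypeR R -> measurableTypeR R).
  exact: mulrl_measurable.
pose phi := *%R a : measurableTypeR R -> measurableTypeR R.
suff muE X : ocitv X ->
    mu X = mscale (NngNum (normr_ge0 a)) (pushforward mu phi) X.
  by rewrite (lebesgue_measure_unique (muE ma) mA).
move=> _ [[x y] _ <-].
rewrite /mscale /phi /= /pushforward (preimage_mul_ocitv _ _ a0).
rewrite lebesgue_measure_itv/= lte_fin.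
have [a_gt0|] := ltP 0 a; rewrite lebesgue_measure_itv/= lte_fin.
  rewrite ltr_pM2r ?invr_gt0//; case: ifPn; rewrite ?mule0// => _.
  by rewrite -!EFinB -EFinM gtr0_norm//; congr EFin; field.
rewrite le_eqVlt (negbTE a0)/= => a_lt0.
rewrite ltr_nM2r ?invr_lt0//; case: ifPn; rewrite ?mule0// => _.
by rewrite -!EFinB -EFinM ltr0_norm//; congr EFin; field.
Qed.

(** Lebesgue measure is [|a|] times its own image under multiplication by [a]; the image-measure
    formula then applies, and the two factors [|a|] cancel. *)
Lemma ge0_integral_dilation (a : R) (f : R -> R) (A : set R) : a != 0 ->
  measurable A -> measurable_fun setT f -> (forall x, 0 <= f x) ->
  (\int[mu]_(x in *%R a @^-1` A) (f x)%:E =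
   \int[mu]_(x in A) (f (x / a) / `|a|)%:E)%E.
Proof.
move=> a0 mA mf f0.
have ma : measurable_fun setT ( *%R a : measurableTypeR R -> measurableTypeR R).
  exact: mulrl_measurable.
pose phi := *%R a : measurableTypeR R -> measurableTypeR R.
have mfa : measurable_fun setT (fun x : measurableTypeR R => (f (x / a) / `|a|)%:E).
  apply/measurable_EFinP; apply: measurable_funM => //.
  by apply: measurableT_comp => //; exact: mulrr_measurable.
have fa0 x : (0 <= (f (x / a) / `|a|)%:E)%E by rewrite lee_fin divr_ge0.
pose nu := mscale (NngNum (normr_ge0 a)) (pushforward mu phi).
(* [nu] is abstracted over the measurability of [phi], which [ma] supplies. *)
transitivity (\int[nu ma]_(x in A) (f (x / a) / `|a|)%:E)%E; last first.
  apply: eq_measure_integral => B mB _.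
  exact: lebesgue_measure_dilation.
rewrite /nu ge0_integral_mscale//; last exact: measurable_funTS.
rewrite ge0_integral_pushforward//; last exact: measurable_funTS.
rewrite -ge0_integralZl//.
- apply: eq_integral => x _ /=.
  rewrite -EFinM; congr EFin.
  by rewrite /phi [a * x]mulrC mulfK// mulrCA divff ?normr_eq0 ?mulr1.
- rewrite -[_ @^-1` _]setTI; exact: ma.
- by apply/measurable_funTS; exact: (measurableT_comp mfa ma).
- by move=> x _; exact: fa0.
Qed.

End lebesgue_dilation.

Lemma powR_continuous_gt0 (R : realType) (a y : R) : 0 < y ->
  {for y, continuous (fun x : R => x `^ a)}.
Proof.
move=> y0; apply/differentiable_continuous/derivable1_diffP.
by apply: derivable_powR; rewrite in_itv/= y0.
Qed.

(** * Distribution function and tails of the Burr III law *)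

Section burr3.
Context {R : realType} (c k : R).
Hypotheses (c_gt0 : 0 < c) (k_gt0 : 0 < k).
Local Notation mu := (@lebesgue_measure R).

Lemma burr3_pdf_ge0 z : 0 <= burr3_pdf c k z.
Proof.
by rewrite /burr3_pdf; case: ifP => // _; rewrite !mulr_ge0 ?powR_ge0 ?ltW.
Qed.

Lemma is_derive_burr3_cdf (z : R) : 0 < z ->
  is_derive z 1 (burr3_cdf c k) (burr3_pdf c k z).
Proof.
move=> z0.
have z1 : 0 < 1 + z `^ (- c) by rewrite addr_gt0 ?powR_gt0.
apply: (@near_eq_is_derive _ _ _ (fun w : R => (1 + w `^ (- c)) `^ (- k))) => //.
  near=> w; rewrite /burr3_cdf; case: ifPn => //.
  by rewrite -leNgt leNgt; suff -> : 0 < w by []; near: w; exact: lt_nbhsr.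
have dh : is_derive z 1 (fun w : R => 1 + w `^ (- c)) (- c * z `^ (- c - 1)).
  rewrite -[- c * _]add0r.
  exact: (is_deriveD (is_derive_cst (1 : R) z 1) (is_derive1_powR (- c) z0)).
have dG := @is_derive1_comp R (fun w : R => w `^ (- k))
  (fun w : R => 1 + w `^ (- c)) z _ _
  (is_derive1_powR (- k) z1) dh.
apply: (is_derive_eq dG).
by rewrite /burr3_pdf z0 !opprD; ring.
Unshelve. all: by end_near. Qed.

Lemma continuous_burr3_pdf (z : R) : 0 < z -> {for z, continuous (burr3_pdf c k)}.
Proof.
move=> z0.
have z1 : 0 < 1 + z `^ (- c) by rewrite addr_gt0 ?powR_gt0.
have : {for z, continuous (fun w : R => c * k * w `^ (- (c + 1)) *
    (1 + w `^ (- c)) `^ (- (k + 1)))}.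
  apply: cvgM; first by apply: cvgM; [exact: cvg_cst|exact: powR_continuous_gt0].
  apply: (@continuous_comp _ _ _ (fun w : R => 1 + w `^ (- c))
    (fun w : R => w `^ (- (k + 1)))); last exact: powR_continuous_gt0.
  by apply: cvgD; [exact: cvg_cst|exact: powR_continuous_gt0].
rewrite /prop_for /continuous_at {2}/burr3_pdf z0.
apply: cvg_trans; apply: near_eq_cvg; near=> w.
rewrite /burr3_pdf; case: ifPn => //.
by rewrite -leNgt leNgt; suff -> : 0 < w by []; near: w; exact: lt_nbhsr.
Unshelve. all: by end_near. Qed.

Lemma cvg_burr3_cdfy : burr3_cdf c k z @[z --> +oo] --> (1 : R).
Proof.
have pow_cvg0 : (z : R) `^ (- c) @[z --> +oo] --> (0 : R).
  have inv_cvg0 : (z : R)^-1 @[z --> +oo] --> (0 : R)^'+.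
    have inv_cvg : (z : R)^-1 @[z --> +oo] --> (0 : R).
      by apply/gtr0_cvgV0 => //; exact: nbhs_pinfty_gt.
    move=> A /inv_cvg A0.
    have {}A0 : \forall z \near +oo, 0 < (z : R)^-1 -> A z^-1 by exact: A0.
    suff : \forall z \near +oo, A (z : R)^-1 by [].
    apply: filterS2 A0 (nbhs_pinfty_gt (num_real 0)) => z Az z0.
    by apply: Az; rewrite invr_gt0.
  apply: cvg_trans (cvg_comp _ _ inv_cvg0 (powR_cvg0 c_gt0)).
  apply: near_eq_cvg; near=> w => /=.
  by rewrite -powR_inv1// -powRrM mulN1r.
have : (1 + (z : R) `^ (- c)) `^ (- k) @[z --> +oo] --> (1 + 0 : R) `^ (- k).
  apply: (@cvg_comp _ _ _ (fun z : R => 1 + z `^ (- c)) (fun w : R => w `^ (- k))).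
    by apply: cvgD; [exact: cvg_cst|exact: pow_cvg0].
  by apply: powR_continuous_gt0; rewrite addr0.
rewrite addr0 powR1.
apply: cvg_trans; apply: near_eq_cvg; near=> w.
by rewrite /burr3_cdf ifT.
Unshelve. all: by end_near. Qed.

Lemma integral_burr3_pdf_cy z : 0 < z ->
  (\int[mu]_(x in `[z, +oo[) (burr3_pdf c k x)%:E = (1 - burr3_cdf c k z)%:E)%E.
Proof.
move=> z0.
(* The argument 1 is the limit of the antiderivative [burr3_cdf] at infinity. *)
rewrite (@ge0_continuous_FTC2y _ _ (burr3_cdf c k) z 1) ?EFinB//.
- by move=> x _; exact: burr3_pdf_ge0.
- apply: continuous_in_subspaceT => x; rewrite inE/= in_itv/= andbT => zx.
  exact: continuous_burr3_pdf (lt_le_trans z0 zx).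
- exact: cvg_burr3_cdfy.
- by move=> x zx; have /@ex_derive := is_derive_burr3_cdf (lt_trans z0 zx).
- apply/cvg_at_right_filter/differentiable_continuous/derivable1_diffP.
  by have /@ex_derive := is_derive_burr3_cdf z0.
- move=> x; rewrite in_itv/= andbT => zx.
  by rewrite derive1E; have /@derive_val -> := is_derive_burr3_cdf (lt_trans z0 zx).
Qed.

Context d (T : measurableType d) (P : probability T R) (Z : {RV P >-> R}).
Hypothesis Z_burr3 : has_density Z (burr3_pdf c k).

Lemma burr3_distribution_ge z :
  distribution P Z `[z, +oo[ = (1 - burr3_cdf c k z)%:E.
Proof.
have [_ _ Zf] := Z_burr3.
have [z0|z0] := ltP 0 z; first by rewrite -integral_burr3_pdf_cy// -Zf.
(* For [z <= 0] the density vanishes on the complement of the tail, so the tail has mass 1. *)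
rewrite -setCitvl probability_setC//= Zf// integral0_eq.
  by rewrite /burr3_cdf ltNge z0 subr0 sube0.
move=> x; rewrite /= in_itv/= => xz.
by rewrite /burr3_pdf ltNge (ltW (lt_le_trans xz z0)).
Qed.

(** The complement is an open tail; a law with a density does not charge the end point, so the
    closed tail has the same mass. *)
Lemma burr3_distribution_le z :
  distribution P Z `]-oo, z] = (burr3_cdf c k z)%:E.
Proof.
have [mf _ Zf] := Z_burr3.
rewrite -setCitvr probability_setC//= Zf// integral_itv_obnd_cbnd; last first.
  exact/measurable_EFinP/measurable_funTS.
by rewrite -Zf// burr3_distribution_ge -EFinB; congr EFin; ring.
Qed.

End burr3.

(** * Product with an independent two-valued factor *)

Lemma distribution_mul_two_valued (R : realType) (d : measure_display)
    (T : measurableType d) (P : probability T R) (Z U : {RV P >-> R})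
    (u v p : R) (A : set R) :
  u != v -> independent_RV Z U ->
  P (U @^-1` [set u]) = p%:E -> P (U @^-1` [set v]) = (1 - p)%:E ->
  measurable A ->
  distribution P (Z * U : {RV P >-> R}) A =
  (distribution P Z ( *%R u @^-1` A) * p%:E +
   distribution P Z ( *%R v @^-1` A) * (1 - p)%:E)%E.
Proof.
move=> uv ZU Pu Pv mA; rewrite /distribution /pushforward.
have mpre (X : {RV P >-> R}) B : measurable B -> measurable (X @^-1` B).
  by move=> mB; rewrite -[_ @^-1` _]setTI; exact: measurable_funPT.
have mmul a : measurable ( *%R a @^-1` A : set R).
  by rewrite -[_ @^-1` _]setTI; exact: mulrl_measurable.
pose X : {RV P >-> R} := Z * U.
(* On the event [U = a] the product is [a * Z], which turns the joint event into one that
   independence factors. *)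
have XE a : X @^-1` A `&` U @^-1` [set a] =
    Z @^-1` ( *%R a @^-1` A) `&` U @^-1` [set a].
  by apply/seteqP; split => t [] ZA Ut; split => //; move: ZA;
    rewrite /preimage/= -Ut mulrC.
have Uuv0 : U @^-1` [set u] `&` U @^-1` [set v] = set0.
  by apply/seteqP; split => t //= [-> /eqP]; rewrite (negbTE uv).
(* The two weights add up to 1, so [U] almost surely takes one of the two values. *)
have Puv : P (~` (U @^-1` [set u] `|` U @^-1` [set v])) = 0%E.
  rewrite probability_setC; last by apply: measurableU; exact: mpre.
  rewrite measureU; [|exact: mpre..|].
    by rewrite /= Pu Pv -EFinD; congr EFin; ring.
  exact: Uuv0.
have mX := mpre X A mA.
have muv : measurable (U @^-1` [set u] `|` U @^-1` [set v]).
  by apply: measurableU; exact: mpre.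
(* Split [X \in A] by whether [U] is one of [u], [v]; the remaining part lies in a null event. *)
rewrite (measureDI P mX muv) setDE [X in (X + _)%E](_ : _ = 0%E); last first.
  apply/eqP; rewrite -measure_le0 -Puv; apply: le_measure; rewrite ?inE//.
  - by apply: measurableI => //; exact: measurableC.
  - exact: measurableC.
rewrite add0e setIUr measureU; first last.
- by rewrite setIACA Uuv0 setI0.
- by apply: measurableI => //; exact: mpre.
- by apply: measurableI => //; exact: mpre.
by rewrite !XE /= !ZU// Pu Pv.
Qed.

Lemma has_density_mul_two_valued (R : realType) (d : measure_display)
    (T : measurableType d) (P : probability T R) (Z U : {RV P >-> R})
    (u v p : R) (g : R -> R) :
  u != 0 -> v != 0 -> u != v -> 0 <= p -> 0 <= 1 - p ->
  has_density Z g -> independent_RV Z U ->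
  P (U @^-1` [set u]) = p%:E -> P (U @^-1` [set v]) = (1 - p)%:E ->
  has_density (Z * U : {RV P >-> R})
    (fun x => g (x / u) / `|u| * p + g (x / v) / `|v| * (1 - p)).
Proof.
move=> u0 v0 uv p0 q0 [mg g0 Zg] ZU Pu Pv.
have mga a D : measurable_fun D (fun x : R => g (x / a) / `|a|).
  apply/measurable_funTS; apply: measurable_funM => //.
  by apply: (measurableT_comp mg); exact: mulrr_measurable.
have mgaq a q D : measurable_fun D (fun x : R => g (x / a) / `|a| * q).
  by apply: measurable_funM.
have ga0 a x : 0 <= g (x / a) / `|a| by rewrite divr_ge0.
split; first exact: measurable_funD.
  by move=> x; rewrite addr_ge0// mulr_ge0.
have mmul (a : R) (A : set R) : measurable A -> measurable ( *%R a @^-1` A : set R).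
  by move=> mA; rewrite -[_ @^-1` _]setTI; exact: mulrl_measurable.
move=> A mA; rewrite (distribution_mul_two_valued uv ZU Pu Pv mA).
rewrite !Zg; [|exact: mmul..].
(* Both integrals now run over [A]; the right side is split by additivity and its weights are pulled
   out to match. *)
rewrite !ge0_integral_dilation//.
under [RHS]eq_integral do rewrite EFinD.
rewrite ge0_integralD//=.
- congr (_ + _)%E; under [RHS]eq_integral do rewrite EFinM.
    rewrite ge0_integralZr//; first by apply/measurable_EFinP; exact: mga.
    by move=> x _; rewrite lee_fin.
  rewrite ge0_integralZr//; first by apply/measurable_EFinP; exact: mga.
  by move=> x _; rewrite lee_fin.
- by move=> x _; rewrite lee_fin mulr_ge0.
- by apply/measurable_EFinP; exact: mgaq.
- by move=> x _; rewrite lee_fin mulr_ge0.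
- by apply/measurable_EFinP; exact: mgaq.
Qed.

(** * The skewed law *)

Lemma skew_burr3_pdfE (R : realType) (c k e x : R) : 0 < c ->
  -1 < e -> e < 1 ->
  skew_burr3_pdf c k e x =
  (burr3_pdf c k (x / (1 + e)) + burr3_pdf c k (x / - (1 - e))) / 2.
Proof.
move=> c_gt0 eN1 e1.
have e1_gt0 : 0 < 1 + e by lra.
have e2_gt0 : 0 < 1 - e by lra.
rewrite /skew_burr3_pdf /burr3_pdf invrN mulrN oppr_gt0.
rewrite pmulr_lgt0 ?invr_gt0// pmulr_llt0 ?invr_gt0//.
(* The two scale factors have opposite signs, so for [x != 0] the guard of exactly one summand
   holds. *)
have [x0|x0|<-] := ltgtP 0 x.
- by rewrite gtr0_sg// !mul1r addr0; field.
- by rewrite ltr0_sg// !mulN1r add0r mulNr; field.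
(* At 0 both sides vanish: the base is 0 and its exponent [- (c + 1)] is nonzero, so [powR] returns
   0. The identity thus holds at every point. *)
- rewrite sgr0 !mul0r powR0 ?mulr0 ?mul0r ?addr0 ?mul0r//.
  by rewrite oppr_eq0 gt_eqF// addr_gt0.
Qed.

Theorem theorem2p1 (R : realType) (d : measure_display) (T : measurableType d)
    (P : probability T R) (c k e : R) (Z U : {RV P >-> R})
    (c_gt0 : 0 < c) (k_gt0 : 0 < k) (e_gtN1 : -1 < e) (e_lt1 : e < 1)
    (Z_burr3 : has_density Z (burr3_pdf c k))
    (ZU_indep : independent_RV Z U)
    (U_pos : P (U @^-1` [set 1 + e]) = ((1 + e) / 2)%:E)
    (U_neg : P (U @^-1` [set - (1 - e)]) = ((1 - e) / 2)%:E) :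
  let X : {RV P >-> R} := Z * U in
  (forall x : R, cdf X x = (skew_burr3_cdf c k e x)%:E) /\
  has_density X (skew_burr3_pdf c k e).
Proof.
move=> X.
have u_gt0 : 0 < 1 + e by lra.
have v_gt0 : 0 < 1 - e by lra.
have u_neq0 : 1 + e != 0 by rewrite gt_eqF.
have v_neq0 : - (1 - e) != 0 by rewrite oppr_eq0 gt_eqF.
have uv : 1 + e != - (1 - e) by rewrite gt_eqF//; lra.
have qE : (1 - e) / 2 = 1 - (1 + e) / 2 by field.
have XA A : measurable A -> distribution P X A =
    (distribution P Z ( *%R (1 + e) @^-1` A) * ((1 + e) / 2)%:E +
     distribution P Z ( *%R (- (1 - e)) @^-1` A) * ((1 - e) / 2)%:E)%E.
  by rewrite qE; apply: distribution_mul_two_valued; rewrite -?qE.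
split=> [x|].
  have preu : *%R (1 + e) @^-1` `]-oo, x] = `]-oo, (x / (1 + e))]%classic.
    apply/seteqP; split=> z;
      by rewrite /= !in_itv/= [(1 + e) * z]mulrC ler_pdivlMr.
  (* The negative factor reverses the half-line, which is why the closed upper tail of [Z]
     enters. *)
  have prev : *%R (- (1 - e)) @^-1` `]-oo, x] = `[(- x / (1 - e)), +oo[%classic.
    apply/seteqP; split=> z;
      by rewrite /= !in_itv/= andbT ler_pdivrMr// mulNr lerNl mulrC.
  rewrite /cdf XA// preu prev (burr3_distribution_le c_gt0 k_gt0 Z_burr3).
  rewrite (burr3_distribution_ge c_gt0 k_gt0 Z_burr3) -!EFinM -EFinD.
  (* For [x >= 0] the argument [- x / (1 - e)] is at most 0, so the negative branch contributes its
     full weight; for [x < 0] the positive branch contributes nothing. *)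
  congr EFin; rewrite /skew_burr3_cdf; case: ifPn => [x0|].
    rewrite [burr3_cdf _ _ (- x / _)]/burr3_cdf pmulr_lgt0 ?invr_gt0//.
    by rewrite oppr_gt0 ltNge x0/=; ring.
  rewrite -ltNge => x0.
  rewrite [burr3_cdf _ _ (x / _)]/burr3_cdf pmulr_lgt0 ?invr_gt0//.
  by rewrite ltNge (ltW x0)/=; ring.
(* Each weight divided by the modulus of its scale factor equals 1/2, the common factor in
   [skew_burr3_pdfE]. *)
have -> : skew_burr3_pdf c k e = fun x =>
    burr3_pdf c k (x / (1 + e)) / `|1 + e| * ((1 + e) / 2) +
    burr3_pdf c k (x / - (1 - e)) / `|- (1 - e)| * (1 - (1 + e) / 2).
  apply/funext => x; rewrite skew_burr3_pdfE// normrN !gtr0_norm// -qE.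
  by rewrite mulrDl !mulrA !divfK ?gt_eqF.
by apply: has_density_mul_two_valued; rewrite -?qE// divr_ge0// ltW.
Qed.
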